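(* Let $X$ and $Y$ be real locally convex topological vector spaces and let $F\colon X\rightrightarrows Y$ be a quasi-nearly convex set-valued mapping. Then $$\operatorname{qi}(\operatorname{gph}(F))\supset\{(x,y)\in X\times Y\mid x\in\operatorname{qi}(\operatorname{dom}(F)),\ y\in\operatorname{qi}(F(x))\}.$$
   Context: For a set-valued mapping $F\colon X\rightrightarrows Y$: $\operatorname{dom}(F)=\{x\mid F(x)\neq\emptyset\}$, $\operatorname{gph}(F)=\{(x,y)\in X\times Y\mid y\in F(x)\}$. For a subset $\Omega$ of a topological vector space $Z$ (not necessarily convex), $\operatorname{cone}(\Omega)=\{\lambda w\mid\lambda\ge0,\ w\in\Omega\}$ and $\overline{\operatorname{cone}}(\Omega)$ is its closure. Define: quasi-interior $\operatorname{qi}(\Omega)=\{z\in\Omega\mid\overline{\operatorname{cone}}(\Omega-z)=Z\}$; quasi-relative interior $\operatorname{qri}(\Omega)=\{z\in\Omega\mid\overline{\operatorname{cone}}(\Omega-z)\text{ is a linear subspace of }Z\}$. A nonempty set $\Omega\subset Z$ is quasi-nearly convex if there is a convex set $C\subset Z$ with $\operatorname{qri}(C)\neq\emptyset$ and $C\subset\Omega\subset\overline{C}$. The mapping $F$ is quasi-nearly convex if $\operatorname{gph}(F)$ is a quasi-nearly convex set in $X\times Y$. *)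

(* Defs.v *)
From mathcomp Require Import all_boot all_order all_algebra.
From mathcomp Require Import all_classical all_reals all_analysis.

Set Implicit Arguments.
Unset Strict Implicit.
Unset Printing Implicit Defensive.

Import Order.TTheory GRing.Theory Num.Theory.
Import numFieldNormedType.Exports.

Local Open Scope classical_set_scope.
Local Open Scope ring_scope.

Section SetValuedMap.
Context {X Y : Type}.
Implicit Type F : X -> set Y.

Definition dom F : set X := [set x | F x !=set0].

Definition gph F : set (X * Y) := [set p | F p.1 p.2].

End SetValuedMap.

Definition cone {R : numDomainType} {Z : lmodType R} (A : set Z) : set Z :=
  [set v | exists2 l : R, 0 <= l & exists2 w, A w & v = l *: w].

Section QuasiInterior.
Context {R : numDomainType} {Z : topologicalLmodType R}.
Implicit Types (A C : set Z) (z : Z).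

Definition closed_cone A : set Z := closure (cone A).

Definition qi A : set Z := [set z | A z /\ closed_cone [set w - z | w in A] = [set: Z]].

Definition qri A : set Z :=
  [set z | A z /\ submod_closed (mem (closed_cone [set w - z | w in A]))].

Definition quasi_nearly_convex A : Prop :=
  A !=set0 /\
  exists C, [/\ convex_set C, qri C !=set0, C `<=` A & A `<=` closure C].

End QuasiInterior.

Definition quasi_nearly_convex_map {R : numFieldType} {X Y : tvsType R}
    (F : X -> set Y) : Prop :=
  quasi_nearly_convex (gph F).

(* Main.v *)
Require Import Defs.
From mathcomp Require Import all_boot all_order all_algebra.
From mathcomp Require Import all_classical all_reals all_analysis.

(** Fix [p = (x, y)] with [x] in the quasi-interior of [dom F] and [y] in that
    of [F x], and let [K] be the closed cone generated by [gph F - p].  If [C]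
    is a convex set squeezed as [C `<=` gph F `<=` closure C], then [K] is also
    the closed cone generated by [C - p], hence is closed under addition
    ([closed_cone_nearly_convexD]).
    The inclusion of [{x} * F x] in [gph F] puts the closed cone of [F x - y],
    which is the whole of [Y], inside the fibre of [K] over [0]; so [K] contains
    [0 * Y] and, being stable under addition, is invariant under vertical
    translations.  Each direction of [cone (dom F - x)] is the first component
    of some direction of [cone (gph F - p)], so [K] contains
    [cone (dom F - x) * Y].  The first factor is dense in [X] and [K] is closed,
    so [K] is everything. *)

Import Order.TTheory GRing.Theory Num.Theory.

Local Open Scope classical_set_scope.
Local Open Scope ring_scope.

Lemma closure_continuous_sub {S T : topologicalType} {f : S -> T}
    {A : set S} {B : set T} :
  continuous f -> (forall a, A a -> closure B (f a)) ->
  forall {a}, closure A a -> closure B (f a).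
Proof.
move=> cf fAB a clAa.
have cl : closed (f @^-1` closure B).
  by apply: closed_comp => [x _|]; [exact: cf|exact: closed_closure].
exact: cl (closureS fAB clAa).
Qed.

Lemma continuous_pair_r (S T : topologicalType) (a : S) :
  continuous (fun b : T => (a, b)).
Proof. by move=> b; apply: cvg_pair; [exact: cvg_cst|exact: cvg_id]. Qed.

Lemma continuous_pair_l (S T : topologicalType) (b : T) :
  continuous (fun a : S => (a, b)).
Proof. by move=> a; apply: cvg_pair; [exact: cvg_id|exact: cvg_cst]. Qed.

Section ClosedCone.
Context {R : numFieldType} {Z : topologicalLmodType R}.
Implicit Types (A C : set Z) (z : Z).

Lemma continuous_addr z : continuous (fun w : Z => w + z).
Proof.
move=> w; apply: (@continuous_comp _ _ _ (fun w : Z => (w, z))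
  (fun u : Z * Z => u.1 + u.2)); first exact: continuous_pair_l.
exact: add_continuous.
Qed.

Lemma continuous_scaler (l : R) : continuous (fun w : Z => l *: w).
Proof.
move=> w; apply: (@continuous_comp Z (R^o * Z)%type Z (fun w : Z => (l : R^o, w))
  (fun u : R^o * Z => u.1 *: u.2)); first exact: continuous_pair_r.
exact: scale_continuous.
Qed.

(** Two separately continuous passages to the limit, one in each summand. *)
Lemma closureD A : (forall a b, A a -> A b -> A (a + b)) ->
  forall a b, closure A a -> closure A b -> closure A (a + b).
Proof.
move=> AD a b clAa clAb.
apply: (closure_continuous_sub (continuous_addr b) _ clAa) => {clAa}a Aa.
rewrite addrC.
apply: (closure_continuous_sub (continuous_addr a) _ clAb) => {clAb}b Ab.
by apply: subset_closure; exact: AD.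
Qed.

(** For [l, m > 0] the sum [l *: u + m *: v] is [l + m] times the convex
    combination of [u] and [v] with weights [l / (l + m)] and [m / (l + m)]. *)
Lemma cone_convexD C z : convex_set C ->
  forall a b, cone [set w - z | w in C] a -> cone [set w - z | w in C] b ->
  cone [set w - z | w in C] (a + b).
Proof.
move=> cC a b [l l0 [_ [u Cu <-] ->]] [m m0 [_ [v Cv <-] ->]].
have [->|ln0] := eqVneq l 0.
  by rewrite scale0r add0r; exists m => //; exists (v - z) => //; exists v.
have [->|mn0] := eqVneq m 0.
  by rewrite scale0r addr0; exists l => //; exists (u - z) => //; exists u.
have lp : 0 < l by rewrite lt_def ln0.
have mp : 0 < m by rewrite lt_def mn0.
have lm0 : l + m != 0 by rewrite gt_eqF// addr_gt0.
have t0 : 0 <= l / (l + m) by rewrite divr_ge0 ?addr_ge0.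
have t1 : l / (l + m) <= 1 by rewrite ler_pdivrMr ?addr_gt0// mul1r lerDl.
have Cw := set_mem (cC u v (Itv01 t0 t1) (mem_set Cu) (mem_set Cv)).
exists (l + m); first by rewrite addr_ge0.
exists ((l / (l + m)) *: u + (1 - l / (l + m)) *: v - z).
  by exists ((l / (l + m)) *: u + (1 - l / (l + m)) *: v).
have -> : 1 - l / (l + m) = m / (l + m).
  by apply: (mulIf lm0); rewrite mulrBl !mulfVK// mul1r addrAC subrr add0r.
rewrite [RHS]scalerBr [in RHS]scalerDr !scalerA ![(l + m) * _]mulrC !mulfVK//.
by rewrite !scalerBr scalerDl opprD addrACA.
Qed.

Lemma closed_cone_sub_closure {A C} z : A `<=` closure C ->
  closed_cone [set w - z | w in A] `<=` closed_cone [set w - z | w in C].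
Proof.
move=> AC a; apply: (closure_continuous_sub (f := idfun)); first by move=> ?; exact: cvg_id.
move=> {}a.
move=> [l l0 [_ [w Aw <-] ->]].
apply: (closure_continuous_sub (f := fun w => l *: (w - z)) _ _ (AC _ Aw)).
  move=> u; apply: (@continuous_comp _ _ _ (fun w : Z => w - z) ( *:%R l)).
    exact: continuous_addr.
  exact: continuous_scaler.
move=> u Cu; apply: subset_closure.
by exists l => //; exists (u - z) => //; exists u.
Qed.

(** Passing from [C] to any set between [C] and [closure C] leaves the closed
    cone unchanged, and that of [C - z] is the closure of a convex cone. *)
Lemma closed_cone_nearly_convexD A C z :
    convex_set C -> C `<=` A -> A `<=` closure C ->
  forall a b, closed_cone [set w - z | w in A] a ->
    closed_cone [set w - z | w in A] b ->
  closed_cone [set w - z | w in A] (a + b).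
Proof.
move=> cC CA AC a b /(closed_cone_sub_closure _ AC) Ka.
move=> /(closed_cone_sub_closure _ AC) Kb.
apply: (@closed_cone_sub_closure C); first exact: subset_trans (@subset_closure _ _).
by apply: closureD Ka Kb => {}a {}b; exact: cone_convexD.
Qed.

End ClosedCone.

Theorem theorem6p5 (R : realType) (X Y : tvsType R) (F : X -> set Y)
    (hF : quasi_nearly_convex_map F) :
  [set p : X * Y | qi (dom F) p.1 /\ qi (F p.1) p.2] `<=` qi (gph F).
Proof.
have [_ [C [cC _ CF FC]]] := hF.
move=> [x y] /= [[_ domT] [Fxy FxT]]; split=> //.
set K := closed_cone _.
have KD a b : K a -> K b -> K (a + b).
  exact: closed_cone_nearly_convexD cC CF FC a b.
have K0 v : K (0, v).
  have : closed_cone [set w - y | w in F x] v by rewrite FxT.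
  apply: (closure_continuous_sub (@continuous_pair_r X Y 0)) => {}v.
  move=> [l l0 [_ [w Fxw <-] ->]]; apply: subset_closure.
  exists l => //; exists ((x, w) - (x, y)); first by exists (x, w).
  by congr pair; rewrite /= subrr scaler0.
apply/seteqP; split=> // -[u v] _.
have : closed_cone [set w - x | w in dom F] u by rewrite domT.
apply: (closure_continuous_sub (@continuous_pair_l X Y v)) => {}u.
move=> [l l0 [_ [w [t Fwt] <-] ->]].
(* [t] is an arbitrary point over [w]; its height is corrected by [K0]. *)
have -> : (l *: (w - x), v) = l *: ((w, t) - (x, y)) + (0, v - l *: (t - y)).
  by congr pair; rewrite /= ?addr0// addrC subrK.
apply: KD (K0 _); apply: subset_closure.
by exists l => //; exists ((w, t) - (x, y)) => //; exists (w, t).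
Qed.
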